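(* Let $G$ be a finitely generated abelian group, $\psi:G\to G$ an injective, non-surjective homomorphism, $G*_{\psi}$ the associated ascending HNN-extension, and $\mathcal{A}$ a finite alphabet. Let $x\in\mathcal{A}^{G*_{\psi}}$, and suppose there exist a subgroup $H\leqslant G$ with $\psi(H)\leqslant H$ and $\ell\ge0$ such that $\psi^{\ell}(H)\leqslant\mathrm{Stab}(x)$. Let $X\subseteq\mathcal{A}^{G*_\psi}$ be a $G*_{\psi}$-subshift containing $x$. Then there exists a configuration $y\in X$ such that all its $G$-sections are $H$-periodic. In particular, if $H=G$ and $X$ is a subshift of finite type, then $X$ contains a strongly periodic configuration for which each $G$-section is monochromatic (that is, the configuration assigns the same symbol to all elements of the $G$-section) and $G$-sections of the same level share the same symbol.
   Context: If $G=\langle S\mid R\rangle$ and $\psi:G\to G$ is a monomorphism, the ascending HNN-extension is $G*_{\psi}=\langle S\cup\{t\}\mid R\cup\{tgt^{-1}=\psi(g): g\in G\}\rangle$; $G$ is regarded as a subgroup of $G*_\psi$, and $\psi^{\ell}$ is the $\ell$-fold composition of $\psi$. For a group $\Lambda$ and a finite discrete set $\mathcal{A}$, $\mathcal{A}^\Lambda$ has the product topology and the shift action $\sigma_g(x)_h=x_{g^{-1}h}$. Its elements are called configurations. $\mathrm{Stab}(x)=\{g\in\Lambda:\sigma_g(x)=x\}$, $\mathrm{Orb}(x)=\{\sigma_g(x):g\in\Lambda\}$; $x$ is strongly periodic if $\mathrm{Orb}(x)$ is finite. A $\Lambda$-subshift is a closed $\sigma$-invariant subset of $\mathcal{A}^\Lambda$.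 It is a subshift of finite type (SFT) if there is a finite family $\mathcal{F}$ of patterns (elements of $\mathcal{A}^F$, $F\subseteq\Lambda$ finite) such that $X$ is the set of all $x$ such that for every finite $F\subseteq \Lambda$ and $g\in\Lambda$, $\sigma_g(x)|_F\notin\mathcal{F}$. For $h\in G*_{\psi}$, the $G$-section containing $h$ is $\Gamma_h=\{hg: g\in G\}$. Every $h\in G*_\psi$ is written uniquely as $h=t^{-j}gt^{i}$ with $i,j\ge0$, $g\in G$, where $g\in\psi(G)$ is allowed only if $i=0$ or $j=0$; the level of $\Gamma_h$ is $i-j$ (this is well defined). For $H\leqslant G$ and $x\in\mathcal{A}^{G*_\psi}$, the $G$-section $\Gamma_h$ of $x$ is $H$-periodic if $x_{hgg'}=x_{hg}$ for all $g\in G$, $g'\in H$. *)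

(* Defs.v *)
From HB Require Import structures.
From mathcomp Require Import all_boot all_order all_algebra.
From mathcomp Require Import finmap.
From mathcomp Require Import boolp classical_sets functions cardinality.
From mathcomp Require Import topology.

Set Implicit Arguments.
Unset Strict Implicit.
Unset Printing Implicit Defensive.

Local Open Scope classical_set_scope.
Local Open Scope group_scope.
Local Open Scope fset_scope.

(* A word in the letters x and x^-1, x : X; the letter (x, false) stands for
   the inverse of (x, true). *)
Definition word (X : choiceType) := seq (X * bool).

Definition inv_word (X : choiceType) (w : word X) : word X :=
  rev [seq (a.1, ~~ a.2) | a <- w].

(* A set of relations between words; (u, v) stands for the relation u = v. *)
Definition relations (X : choiceType) := set (word X * word X).

Inductive word_congr (X : choiceType) (R : relations X) :
  word X -> word X -> Prop :=
| word_congr_rel u v : R (u, v) -> word_congr R u v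
| word_congr_cancel x b : word_congr R [:: (x, b); (x, ~~ b)] [::]
| word_congr_refl u : word_congr R u u
| word_congr_sym u v : word_congr R u v -> word_congr R v u
| word_congr_trans u v w :
    word_congr R u v -> word_congr R v w -> word_congr R u w
| word_congr_cat u u' v v' :
    word_congr R u u' -> word_congr R v v' -> word_congr R (u ++ v) (u' ++ v').

Section Presentation.
Variables (X : choiceType) (R : relations X).

Definition word_eqv : rel (word X) := fun u v => `[< word_congr R u v >].

Lemma word_eqv_refl : reflexive word_eqv.
Proof. by move=> u; apply/asboolP; exact: word_congr_refl. Qed.

Lemma word_eqv_sym : symmetric word_eqv.
Proof.
by move=> u v; apply/asboolP/asboolP => /word_congr_sym.
Qed.

Lemma word_eqv_trans : transitive word_eqv.
Proof.
move=> v u w /asboolP uv /asboolP vw; apply/asboolP.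
exact: word_congr_trans uv vw.
Qed.

Canonical word_equiv_rel :=
  EquivRel word_eqv word_eqv_refl word_eqv_sym word_eqv_trans.

(* The group <X | R>. *)
Definition presented : Type := {eq_quot word_equiv_rel}%qT.

HB.instance Definition _ := Choice.on presented.

Definition class_of_word (w : word X) : presented := (\pi_({eq_quot word_equiv_rel}) w)%qT.

Definition word_of_class (a : presented) : word X :=
  repr (a : {eq_quot word_equiv_rel}%qT).

Lemma word_of_classK a : class_of_word (word_of_class a) = a.
Proof. exact: reprK. Qed.

Lemma class_of_wordP u v :
  class_of_word u = class_of_word v <-> word_congr R u v.
Proof.
split=> [/eqmodP /asboolP //|uv]; apply/eqmodP; exact/asboolP.
Qed.

Definition presented_mul (a b : presented) : presented :=
  class_of_word (word_of_class a ++ word_of_class b).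

Definition presented_one : presented := class_of_word [::].

Definition presented_inv (a : presented) : presented :=
  class_of_word (inv_word (word_of_class a)).

Lemma presented_mulE u v :
  presented_mul (class_of_word u) (class_of_word v) = class_of_word (u ++ v).
Proof.
by apply/class_of_wordP; apply: word_congr_cat; apply/class_of_wordP;
  rewrite word_of_classK.
Qed.

Lemma inv_word_l u : word_congr R (inv_word u ++ u) [::].
Proof.
elim: u => [|[x b] u IHu]; first exact: word_congr_refl.
rewrite /inv_word /= rev_cons -cats1 -catA.
apply: word_congr_trans IHu; apply: word_congr_cat; first exact: word_congr_refl.
rewrite -[X in word_congr _ _ X]cat0s -[_ :: u]cat1s catA.
apply: word_congr_cat; last exact: word_congr_refl.
by rewrite -{2}[b]negbK; exact: word_congr_cancel.
Qed.

Lemma inv_word_r u : word_congr R (u ++ inv_word u) [::].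
Proof.
have {1}-> : u = inv_word (inv_word u).
  rewrite /inv_word map_rev revK -map_comp -[LHS]map_id.
  by apply: eq_map => -[x b] /=; rewrite negbK.
exact: inv_word_l.
Qed.

Lemma presented_mulA : associative presented_mul.
Proof.
move=> a b c; rewrite -(word_of_classK a) -(word_of_classK b) -(word_of_classK c).
by rewrite !presented_mulE catA.
Qed.

Lemma presented_mul1 : left_id presented_one presented_mul.
Proof. by move=> a; rewrite -(word_of_classK a) presented_mulE. Qed.

Lemma presented_mulr1 : right_id presented_one presented_mul.
Proof. by move=> a; rewrite -(word_of_classK a) presented_mulE cats0. Qed.

Lemma presented_mulV : left_inverse presented_one presented_inv presented_mul.
Proof.
move=> a; rewrite -{2}(word_of_classK a) presented_mulE.
exact/class_of_wordP/inv_word_l.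
Qed.

Lemma presented_mulrV : right_inverse presented_one presented_inv presented_mul.
Proof.
move=> a; rewrite -{1}(word_of_classK a) presented_mulE.
exact/class_of_wordP/inv_word_r.
Qed.

HB.instance Definition _ := isGroup.Build presented
  presented_mulA presented_mul1 presented_mulr1 presented_mulV presented_mulrV.

Lemma class_of_wordM u v :
  class_of_word u * class_of_word v = class_of_word (u ++ v).
Proof. exact: presented_mulE. Qed.

Definition generator (x : X) : presented := class_of_word [:: (x, true)].

End Presentation.

Definition subgroup (G : groupType) (H : set G) : Prop :=
  [/\ H 1, forall a b, H a -> H b -> H (a * b) & forall a, H a -> H a^-1].

Definition finitely_generated (G : groupType) : Prop :=
  exists s : seq G, forall K : set G,
    subgroup K -> (forall a, a \in s -> K a) -> K = setT.

Section HNN.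
Variables (G : groupType) (psi : G -> G).

(* G is presented by all its elements and its multiplication table; None is
   the stable letter t. *)
Inductive hnn_relations : relations (option G) :=
| hnn_relations_base g h : hnn_relations
    ([:: (Some g, true); (Some h, true)], [:: (Some (g * h), true)])
| hnn_relations_stable g : hnn_relations
    ([:: (None, true); (Some g, true); (None, false)], [:: (Some (psi g), true)]).

Definition hnn : groupType := presented hnn_relations.

Definition hnn_base (g : G) : hnn := generator hnn_relations (Some g).

Definition hnn_stable : hnn := generator hnn_relations None.

Definition gsection (h : hnn) : set hnn := [set h * hnn_base g | g in setT].

(* Level of the section containing h, read off a normal form of h; see
   has_level_total and has_level_unique below. *)
Definition has_level (h : hnn) (n : int) : Prop :=
  exists (j : nat) (g : G) (i : nat),
    [/\ h = hnn_stable ^- j * hnn_base g * hnn_stable ^+ i,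
        range psi g -> i = 0%N \/ j = 0%N
      & n = (i%:Z - j%:Z)%R].

Lemma hnn_baseM g h : hnn_base (g * h) = hnn_base g * hnn_base h.
Proof.
rewrite /hnn_base /generator class_of_wordM; apply/class_of_wordP.
exact/word_congr_sym/word_congr_rel/hnn_relations_base.
Qed.

Lemma hnn_stableJ g :
  hnn_stable * hnn_base g * hnn_stable^-1 = hnn_base (psi g).
Proof.
have -> : hnn_stable^-1 = class_of_word hnn_relations [:: (None, false)].
  apply: (mulgI hnn_stable); rewrite mulgV /hnn_stable /generator.
  rewrite class_of_wordM; apply/class_of_wordP/word_congr_sym.
  exact: word_congr_cancel.
rewrite /hnn_base /hnn_stable /generator (class_of_wordM _ [:: _] [:: _]).
rewrite (class_of_wordM _ [:: _; _] [:: _]).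
exact/class_of_wordP/word_congr_rel/hnn_relations_stable.
Qed.

End HNN.

Section Level.
Variables (G : groupType) (psi : {multiplicative G -> G}).

Local Notation t := (hnn_stable psi).
Local Notation b := (hnn_base psi).

Let tb g : t * b g = b (psi g) * t.
Proof. by rewrite -hnn_stableJ mulgVK. Qed.

Lemma hnn_base1 : b 1 = 1.
Proof. by apply: (mulgI (b 1)); rewrite -hnn_baseM !mulg1. Qed.

Lemma hnn_ind (P : hnn psi -> Prop) :
  P 1 -> (forall h, P h -> P (t * h)) -> (forall h, P h -> P (t^-1 * h)) ->
  (forall g h, P h -> P (b g * h)) -> forall h, P h.
Proof.
move=> P1 Pt PtV Pb h; rewrite -(word_of_classK h).
elim: (word_of_class h) => [|[[g|] e] w]; first exact: P1.
- have -> : class_of_word (hnn_relations psi) ((Some g, e) :: w) =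
     class_of_word (hnn_relations psi) [:: (Some g, e)] *
     class_of_word (hnn_relations psi) w by rewrite class_of_wordM.
  case: e => [|Pw]; first exact: Pb.
  suff -> : class_of_word (hnn_relations psi) [:: (Some g, false)] = b g^-1.
    exact: Pb.
  apply: (mulgI (b g)); rewrite -hnn_baseM mulgV hnn_base1.
  rewrite class_of_wordM; apply/class_of_wordP.
  exact: word_congr_cancel.
have -> : class_of_word (hnn_relations psi) ((None, e) :: w) =
   class_of_word (hnn_relations psi) [:: (None, e)] *
   class_of_word (hnn_relations psi) w by rewrite class_of_wordM.
case: e => [|Pw]; first exact: Pt.
suff -> : class_of_word (hnn_relations psi) [:: (None, false)] = t^-1.
  exact: PtV.
apply: (mulgI t); rewrite mulgV class_of_wordM; apply/class_of_wordP.
exact: word_congr_cancel.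
Qed.

Lemma has_level_total (h : hnn psi) : exists n, has_level h n.
Proof.
suff [j [g [i hE]]] : exists j g i, h = t ^- j * b g * t ^+ i.
  elim: j g i hE => [|j IHj] g i hE.
    by exists (i%:Z - 0%:Z)%R, 0%N, g, i; split=> // _; right.
  have [[g' _ gE]|Ng] := pselect (range psi g); last first.
    by exists (i%:Z - j.+1%:Z)%R, j.+1, g, i; split.
  case: i hE => [|i] hE.
    by exists (0%:Z - j.+1%:Z)%R, j.+1, g, 0%N; split=> // _; left.
  apply: (IHj g' i); rewrite hE -gE !expgS invgM !mulgA.
  by rewrite -hnn_stableJ !mulgA mulgVK mulgVK.
elim/hnn_ind: h => [|h|h|g' h].
- by exists 0%N, 1, 0%N; rewrite hnn_base1 !expg0 invg1 !mulg1.
- move=> [[|j] [g [i ->]]].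
    by exists 0%N, (psi g), i.+1; rewrite expg0 invg1 !mul1g mulgA tb expgS mulgA.
  by exists j, g, i; rewrite expgSr invgM !mulgA mulgV mul1g.
- move=> [j [g [i ->]]].
  by exists j.+1, g, i; rewrite expgSr invgM !mulgA.
- move=> [j [g [i ->]]]; exists j, (iter j psi g' * g), i.
  suff E : b g' * t ^- j = t ^- j * b (iter j psi g').
    by rewrite hnn_baseM !mulgA E.
  apply: (mulgI (t ^+ j)); rewrite mulgA mulVKg.
  apply: (mulIg (t ^+ j)); rewrite mulgVK.
  elim: j => [|j IHj]; first by rewrite expg0 mul1g mulg1.
  by rewrite expgS -mulgA IHj mulgA tb -mulgA.
Qed.

Let wlevel (w : word (option G)) : int :=
  (\sum_(a <- w) (if a.1 is Some _ then 0 else if a.2 then 1 else -1))%R.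

Let wlevel_rel r : hnn_relations psi r -> wlevel r.1 = wlevel r.2.
Proof. by case=> [g h|g]; rewrite /wlevel !big_cons !big_nil. Qed.

Let wlevel_congr u v : word_congr (hnn_relations psi) u v -> wlevel u = wlevel v.
Proof.
elim=> {u v} [u v|y e| | | |u u' v v' _ + _].
- exact: wlevel_rel.
- by rewrite /wlevel !big_cons !big_nil; case: y e => [?|] [].
- by [].
- by [].
- by move=> u v w _ -> _ ->.
by rewrite /wlevel !big_cat /= => -> ->.
Qed.

Let lev (h : hnn psi) := wlevel (word_of_class h).

Let levE w : lev (class_of_word (hnn_relations psi) w) = wlevel w.
Proof. by apply/wlevel_congr/class_of_wordP; rewrite word_of_classK. Qed.

Let levM h h' : lev (h * h') = (lev h + lev h')%R.
Proof.
rewrite -(word_of_classK h) -(word_of_classK h') class_of_wordM !levE.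
by rewrite /wlevel big_cat.
Qed.

Lemma has_level_unique (h : hnn psi) n m : has_level h n -> has_level h m -> n = m.
Proof.
suff H k : has_level h k -> k = lev h by move=> /H -> /H ->.
move=> [j [g [i [-> _ ->]]]].
have levb a : lev (b a) = 0%R by rewrite levE /wlevel big_seq1.
have lev1 : lev 1 = 0%R by rewrite -hnn_base1 levb.
have levX a : lev (t ^+ a) = a%:Z%R.
  elim: a => [|a IHa]; first by rewrite expg0 lev1.
  by rewrite expgS levM IHa levE /wlevel big_seq1 -[in RHS]add1n PoszD.
have levV a : lev (t ^- a) = (- a%:Z)%R.
  by apply/eqP; rewrite -GRing.addr_eq0 -levX -levM mulVg lev1.
by rewrite !levM levb GRing.addr0 levV levX GRing.addrC.
Qed.

End Level.

Section Subshifts.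
Variables (L : groupType) (A : finType).

Definition config := {ptws L -> discrete_topology A}.

Definition shift (g : L) (x : config) : config := fun h => x (g^-1 * h).

Definition Stab (x : config) : set L := [set g | shift g x = x].

Definition Orb (x : config) : set config := [set shift g x | g in setT].

Definition strongly_periodic (x : config) : Prop := finite_set (Orb x).

Definition subshift (X : set config) : Prop :=
  closed X /\ forall g x, X x -> X (shift g x).

(* An element of A^F with F finite is a finite map of domain F. *)
Definition pattern := {fmap L -> A}.

Definition restrict (F : {fset L}) (x : config) : pattern :=
  [fmap h : F => x (val h)].

Definition SFT (X : set config) : Prop :=
  exists Fs : {fset pattern},
    X = [set x | forall (F : {fset L}) g, restrict F (shift g x) \notin Fs].

End Subshifts.

Definition section_periodic (G : groupType) (psi : G -> G) (A : finType)
    (H : set G) (x : config (hnn psi) A) (h : hnn psi) : Prop :=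
  forall g g', H g' ->
    x (h * hnn_base psi g * hnn_base psi g') = x (h * hnn_base psi g).

(* Main.v *)
Require Import Defs.
From HB Require Import structures.
From mathcomp Require Import all_boot all_order all_algebra.
From mathcomp Require Import finmap.
From mathcomp Require Import boolp classical_sets functions cardinality.
From mathcomp Require Import topology.
From mathcomp Require Import zify.

Set Implicit Arguments.
Unset Strict Implicit.
Unset Printing Implicit Defensive.

Local Open Scope classical_set_scope.
Local Open Scope group_scope.

(** The relation [t g t^-1 = psi g] gives [t^n g = psi^n(g) t^n]. Hence, if
[h = t^-j k t^i] and [n >= j], then
[t^n h g g' = psi^(n-j)(k) psi^(n-j+i)(g) psi^(n-j+i)(g') t^(n-j+i)], and as
the group is abelian the factor coming from [g'] can be brought to the front.
When [g'] lies in [H] and [n >= j + l] this factor lies in [psi^l(H)], so it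
fixes [x], and [x (t^n h g g') = x (t^n h g)]: for each section, the translate
of [x] by [t^-n] is [H]-periodic on that section as soon as [n] is large
([translate_section_periodic]). By compactness these translates, which lie in
[X], have a cluster point [y] in [X]; since the alphabet is discrete, every
equality between the symbols at two places that holds eventually along the
translates holds for [y] ([limit_config]).

If [H] is the whole group then, in addition, [psi^(n-j)(k)] fixes [x] for [n]
large, so that [x (t^n h) = x (t^(n + level h))] ([translate_level]) and the
same [y] depends only on the level: [y = f \o level] for some [f] on the
integers. The level is a surjective homomorphism to the integers, so the
configurations of [X] that factor through it amount to a subshift of finite
type over the integers. Such a subshift contains a periodic point as soon as it
is nonempty, by the pigeonhole principle ([periodic_windows]), and the pullback
of a periodic point has a finite orbit ([SFT_periodic]).
*)

(** * Limits of configurations *)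

(** An equality between two coordinates that holds eventually passes to a
cluster point, because the evaluations are continuous and [A] is discrete. *)
Lemma limit_config (L : groupType) (A : finType) (X : set (config L A))
    (s : nat -> config L A) :
  closed X -> (forall n, X (s n)) ->
  exists2 y, X y &
    forall u v, (\forall n \near \oo, s n u = s n v) -> y u = y v.
Proof.
move=> Xcl Xs.
have compactT : compact [set z : config L A | forall u, [set: A] (z u)].
  apply: (@tychonoff L (fun=> discrete_topology A) (fun=> setT)) => u.
  exact/finite_compact/(@finite_finset A).
have [|y [_ cly]] := compactT (s @ \oo) _; first by apply: filterE => n u.
exists y.
  apply: Xcl => B /cly - /(_ X); apply.
  by exists 0%N => // n _; exact: Xs.
move=> u v suv.
have nbhs_eval w : nbhs y [set z : config L A | z w = y w].
  have := @proj_continuous L (fun=> discrete_topology A) w y [set y w].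
  apply; apply: open_nbhs_nbhs; split=> //; exact: discrete_open.
have [z [zuv [/= zu zv]]] :=
  cly [set z | z u = z v] _ suv (filterI (nbhs_eval u) (nbhs_eval v)).
by rewrite -zu -zv.
Qed.

(** * Periodic points over the integers *)

(** By pigeonhole [f] has equal windows of length [W] at some [a < b]. Repeating
the values of [f] at the positions from [a] to [b - 1] creates no new window:
the equality of the two windows makes the periodic sequence agree with [f]
(up to the translation by [a]) from position [a] to position [b + W - 1], and
this stretch contains a window starting at each residue modulo the period. *)
Lemma periodic_windows (A : finType) (f : int -> A) (W : nat) :
  exists (d : nat) (p : int -> A), [/\ (0 < d)%N,
    forall k, p k = p (k %% d)%Z
  & forall k, exists k', forall i : nat, (i < W)%N ->
      p (k + i%:Z)%R = f (k' + i%:Z)%R].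
Proof.
pose w (a : 'I_#|{ffun 'I_W -> A}|.+1) := [ffun i : 'I_W => f (a%:Z + i%:Z)%R].
have [a [b [ab wab]]] : exists a b : 'I_#|{ffun 'I_W -> A}|.+1,
    (a < b)%N /\ w a = w b.
  have /injectivePn [a [b Nab wab]] : ~~ injectiveb w.
    by apply/injectiveP => /leq_card; rewrite card_ord ltnn.
  by case: (ltngtP a b) => [ab|ba|/val_inj E];
    [exists a, b|exists b, a|rewrite E eqxx in Nab].
pose d := (b - a)%N; have d_gt0 : (0 < d)%N by rewrite subn_gt0.
pose p (k : int) := f (a%:Z + (k %% d)%Z)%R.
have pmod k : p k = p (k %% d)%Z by rewrite /p modz_mod.
have pE i : (i < d + W)%N -> f (a%:Z + i%:Z)%R = p (Posz i).
  elim/ltn_ind: i => i IH ltiW; have [ltid|leid] := ltnP i d.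
    by rewrite /p modz_nat modn_small.
  have ltiW' : (i - d < W)%N by rewrite ltn_subLR.
  have /ffunP/(_ (Ordinal ltiW')) := wab; rewrite !ffunE /= => fE.
  have -> : (a%:Z + i%:Z = b%:Z + (i - d)%N%:Z)%R by rewrite /d; lia.
  rewrite -fE IH ?ltn_subrL ?d_gt0; [|lia|lia].
  by rewrite /p !modz_nat -{2}(subnK leid) modnDr.
exists d, p; split=> // k; exists (a%:Z + (k %% d)%Z)%R => i ltiW.
have k_ge0 : (0 <= (k %% d)%Z)%R by rewrite modz_ge0 // -lt0n.
have k_ltd : ((k %% d)%Z < d%:Z)%R by exact: ltz_pmod.
rewrite pmod -modzDml -pmod.
move: k_ge0 k_ltd; case: (k %% d)%Z => // r _ ltrd.
by rewrite -GRing.addrA -PoszD pE //; lia.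
Qed.

(** A forbidden pattern has a finite domain, so its occurrence in [f \o lev]
depends on a window of [f] of bounded length. A periodic sequence all of whose
windows of that length occur in [f] therefore avoids the forbidden patterns
too; its pullback has an orbit no larger than the period. *)
Lemma SFT_periodic (L : groupType) (A : finType) (lev : L -> int)
    (X : set (config L A)) (f : int -> A) :
  {morph lev : a b / a * b >-> (a + b)%R} -> (forall n, exists g, lev g = n) ->
  SFT X -> X (f \o lev) ->
  exists2 p : int -> A, X (p \o lev) & strongly_periodic (p \o lev : config L A).
Proof.
move=> levM lev_surj [Fs ->] /= Xf.
have lev1 : lev 1 = 0%R by have := levM 1 1; rewrite mulg1; lia.
have levV g : lev g^-1 = (- lev g)%R.
  by have := levM g g^-1; rewrite mulgV lev1; lia.
pose N := \max_(P <- Fs) \max_(h <- domf P) `|lev h|%N.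
have leN (P : pattern L A) h : P \in Fs -> h \in domf P -> (`|lev h| <= N)%N.
  move=> PFs hP; apply: leq_trans (leq_bigmax_seq _ PFs _) => //.
  exact: (@leq_bigmax_seq _ _ xpredT (fun h => `|lev h|%N) h hP isT).
have [d [p [d_gt0 pmod pW]]] := periodic_windows f (N.*2.+1).
exists p.
  move=> F g; apply/negP => inFs.
  (* The levels of the elements of F lie in [-N, N], so the part of p seen by F
     after shifting by g is the window of length 2N+1 that starts at
     - lev g - N. *)
  have [k' pE] := pW (- lev g - N%:Z)%R.
  have [g' levg'] := lev_surj (- k' - N%:Z)%R.
  suff E : Defs.restrict F (shift g (p \o lev)) =
      Defs.restrict F (shift g' (f \o lev)).
    by have := Xf F g'; rewrite -E inFs.
  apply/fmapP => h; rewrite /Defs.restrict.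
  have [hF|NhF] := boolP (h \in F); last by rewrite !not_fnd.
  rewrite !(in_fnd hF) !ffunE /shift /= !levM !levV levg'.
  have {}hF : (`|lev h| <= N)%N by apply: leN inFs _.
  have := pE `|(lev h + N%:Z)%R|%N.
  have -> : (- lev g - N%:Z + `|(lev h + N%:Z)%R|%N = - lev g + lev h)%R by lia.
  have -> : (k' + `|(lev h + N%:Z)%R|%N = - (- k' - N%:Z) + lev h)%R by lia.
  by move=> ->; [|lia].
rewrite /strongly_periodic.
have -> : Orb (p \o lev) =
    [set ((fun h => p (lev h - i%:Z)%R) : config L A) | i in `I_d].
  apply/seteqP; split=> [_ [g _ <-]|_ [i _ <-]].
    exists `|(lev g %% d)%Z|%N.
      by rewrite /= -ltz_nat gez0_abs ?modz_ge0 ?ltz_pmod// -lt0n.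
    apply/funext => h; rewrite /shift /= levM levV gez0_abs ?modz_ge0 -?lt0n//.
    have -> : (- lev g + lev h =
        - (lev g %/ d)%Z * d + (lev h - (lev g %% d)%Z))%R.
      by have := divz_eq (lev g) d; lia.
    by rewrite [RHS]pmod modzMDl -pmod.
  have [g levg] := lev_surj (Posz i); exists g => //.
  by apply/funext => h; rewrite /shift /= levM levV levg GRing.addrC.
exact/finite_image/finite_II.
Qed.

(** * The level homomorphism *)

Section HNNLevel.
Variables (G : groupType) (psi : {multiplicative G -> G}).

Local Notation t := (hnn_stable psi).
Local Notation b := (hnn_base psi).

Lemma stableX_base n g : t ^+ n * b g = b (iter n psi g) * t ^+ n.
Proof.
elim: n g => [|n IHn] g; first by rewrite mul1g mulg1.
rewrite expgS -mulgA IHn /= -hnn_stableJ !mulgA.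
by rewrite -[t * _ * t^-1 * t]mulgA mulVg mulg1.
Qed.

Lemma base_stableV n g : b g * t ^- n = t ^- n * b (iter n psi g).
Proof.
by apply: (mulgI (t ^+ n)); rewrite !mulgA stableX_base mulgV mul1g mulgK.
Qed.

Lemma normal_form (h : hnn psi) :
  exists (j : nat) g (i : nat), h = t ^- j * b g * t ^+ i.
Proof.
by have [n [j [g [i [-> _ _]]]]] := has_level_total h; exists j, g, i.
Qed.

(** Translating by a large power of [t] moves every element to a place where
the base part has been pushed through many iterates of [psi], so that it ends
up in any subgroup containing the images of high iterates. *)
Lemma stableX_normal_form n j g i : (j <= n)%N ->
  t ^+ n * (t ^- j * b g * t ^+ i) = b (iter (n - j) psi g) * t ^+ (n - j + i).
Proof.
move=> jn; rewrite -{1}(subnK jn) expgnDr !mulgA mulgK stableX_base.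
by rewrite -mulgA -expgnDr.
Qed.

(** The level may be read off any expression [t^-j g t^i], reduced or not:
the reduction [t^-(j+1) psi(g) t^(i+1) = t^-j g t^i] preserves [i - j]. *)
Lemma has_level_normal_form j g i :
  has_level (t ^- j * b g * t ^+ i) (i%:Z - j%:Z)%R.
Proof.
elim: j g i => [|j IHj] g i; first by exists 0%N, g, i; split=> // _; right.
have [[g' _ <-]|Ng] := pselect (range psi g); last first.
  by exists j.+1, g, i; split.
case: i => [|i]; first by exists j.+1, (psi g'), 0%N; split=> // _; left.
have -> : t ^- j.+1 * b (psi g') * t ^+ i.+1 = t ^- j * b g' * t ^+ i.
  by rewrite !expgS invgM -hnn_stableJ !mulgA !mulgVK.
by have -> : (i.+1%:Z - j.+1%:Z = i%:Z - j%:Z)%R by lia.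
Qed.

Definition level (h : hnn psi) : int := projT1 (cid (has_level_total h)).

Lemma has_level_level h : has_level h (level h).
Proof. exact: projT2 (cid (has_level_total h)). Qed.

Lemma level_normal_form j g i :
  level (t ^- j * b g * t ^+ i) = (i%:Z - j%:Z)%R.
Proof.
exact: has_level_unique (has_level_level _) (has_level_normal_form _ _ _).
Qed.

Lemma level_baseM g h : level (b g * h) = level h.
Proof.
have [j [k [i ->]]] := normal_form h.
rewrite !mulgA base_stableV -(mulgA _ (b _) (b _)) -hnn_baseM.
by rewrite !level_normal_form.
Qed.

Lemma level_stableVM h : level (t^-1 * h) = (level h - 1)%R.
Proof.
have [j [k [i ->]]] := normal_form h.
by rewrite !mulgA -invgM -expgSr !level_normal_form; lia.
Qed.

Lemma level_stableM h : level (t * h) = (level h + 1)%R.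
Proof. by have := level_stableVM (t * h); rewrite mulKg; lia. Qed.

Lemma levelM : {morph level : h k / h * k >-> (h + k)%R}.
Proof.
move=> h k; elim/hnn_ind: h => [|h|h|g h].
- suff -> : level 1 = 0%R by rewrite mul1g GRing.add0r.
  by have := level_normal_form 0 1 0; rewrite hnn_base1 invg1 !mulg1.
- by rewrite -mulgA !level_stableM => ->; lia.
- by rewrite -mulgA !level_stableVM => ->; lia.
- by rewrite -mulgA !level_baseM.
Qed.

Lemma level_base g : level (b g) = 0%R.
Proof. by have := level_baseM g (b g); rewrite levelM; lia. Qed.

Lemma level_surj n : exists h, level h = n.
Proof.
case: n => n; [exists (t ^- 0 * b 1 * t ^+ n)|exists (t ^- n.+1 * b 1 * t ^+ 0)].
  by rewrite level_normal_form; lia.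
by rewrite level_normal_form; lia.
Qed.

End HNNLevel.

(** * Translates by negative powers of the stable letter *)

Lemma Stab_mull (L : groupType) (A : finType) (x : config L A) k h :
  Stab x k -> x (k * h) = x h.
Proof. by move=> kx; rewrite -{1}[x]kx /shift mulKg. Qed.

Section StabilizedByPower.
Variables (G : groupType) (psi : {multiplicative G -> G}) (A : finType).
Variables (x : config (hnn psi) A) (H : set G) (l : nat).
Hypothesis G_abelian : forall a b : G, a * b = b * a.
Hypothesis H_psi : psi @` H `<=` H.
Hypothesis H_stab : hnn_base psi @` (iter l psi @` H) `<=` Stab x.

Local Notation t := (hnn_stable psi).
Local Notation b := (hnn_base psi).

(** As [H] is stable under [psi], the subgroups [psi^n(H)] decrease, so all of
them from [n = l] on stabilize [x]. *)
Lemma iter_stab n g h : (l <= n)%N -> H g -> x (b (iter n psi g) * h) = x h.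
Proof.
move=> ln Hg; apply/Stab_mull/H_stab.
exists (iter n psi g) => //; exists (iter (n - l) psi g).
  elim: (n - l)%N => [//|m IHm].
  by apply: H_psi; exists (iter m psi g).
by rewrite -iterD subnKC.
Qed.

(** Commutativity is what allows the image of [g'], which appears on the right,
to act on [x] through its left stabilizer. *)
Lemma translate_section_periodic h g g' : H g' -> \forall n \near \oo,
  x (t ^+ n * (h * b g * b g')) = x (t ^+ n * (h * b g)).
Proof.
move=> Hg'; have [j [k [i ->]]] := normal_form h.
exists (j + l)%N => // n /= jln; have jn : (j <= n)%N by lia.
have := stableX_normal_form psi k i jn.
move: (t ^- j * _ * _) => w nE; rewrite !mulgA nE.
rewrite -(mulgA _ (t ^+ _) (b g)) stableX_base mulgA.
rewrite -(mulgA _ (t ^+ _) (b g')) stableX_base mulgA -!hnn_baseM.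
by rewrite G_abelian hnn_baseM -mulgA iter_stab //; lia.
Qed.

(** The exponent is the integer [n + level h], which is nonnegative for the
large [n] concerned; the absolute value only makes it a natural number. *)
Lemma translate_level h : H = setT -> \forall n \near \oo,
  x (t ^+ n * h) = x (t ^+ `|(n%:Z + level h)%R|).
Proof.
move=> HT; have [j [k [i ->]]] := normal_form h.
exists (j + l)%N => // n /= jln; have jn : (j <= n)%N by lia.
rewrite level_normal_form stableX_normal_form // iter_stab ?HT //; last by lia.
by congr (x (t ^+ _)); lia.
Qed.

End StabilizedByPower.

Theorem theorem3p3 (G : groupType) (psi : {multiplicative G -> G})
    (A : finType)
    (G_fg : finitely_generated G)
    (G_abelian : forall a b : G, a * b = b * a)
    (psi_inj : injective psi)
    (psi_nsurj : range psi <> setT)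
    (x : config (hnn psi) A)
    (H : set G) (H_subgroup : subgroup H)
    (H_psi : psi @` H `<=` H)
    (l : nat)
    (H_stab : hnn_base psi @` (iter l psi @` H) `<=` Stab x)
    (X : set (config (hnn psi) A)) (X_subshift : subshift X)
    (x_in_X : X x) :
  (exists2 y, X y & forall h, section_periodic H y h) /\
  (H = setT -> SFT X ->
   exists y, [/\ X y,
     strongly_periodic y,
     forall h, exists a : A, forall u, gsection h u -> y u = a
   & forall h h' (n : int), has_level h n -> has_level h' n ->
       forall u u', gsection h u -> gsection h' u' -> y u = y u']).
Proof.
have [Xcl Xshift] := X_subshift.
have sE n u : shift (hnn_stable psi ^- n) x u = x (hnn_stable psi ^+ n * u).
  by rewrite /shift invgK.
have [y Xy limy] :=
  limit_config Xcl (fun n => Xshift (hnn_stable psi ^- n) _ x_in_X).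
split.
  exists y => // h g g' Hg'; apply: limy.
  have := translate_section_periodic G_abelian H_psi H_stab h g Hg'.
  by apply: filterS => n; rewrite !sE.
move=> HT XSFT.
have ylev u v : level u = level v -> y u = y v.
  move=> uv; apply: limy; have tl h := translate_level H_psi H_stab h HT.
  by apply: filterS2 (tl u) (tl v) => n; rewrite !sE uv => -> ->.
have [f yE] : exists f : int -> A, y = f \o @level G psi.
  exists (fun n => y (projT1 (cid (level_surj psi n)))).
  apply/funext => h; apply: ylev.
  by rewrite /= (projT2 (cid (level_surj psi _))).
rewrite yE in Xy.
have [p Xp pper] := SFT_periodic (@levelM G psi) (@level_surj G psi) XSFT Xy.
have level_section (h u : hnn psi) : gsection h u -> level u = level h.
  by move=> [g _ <-]; rewrite levelM level_base GRing.addr0.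
exists (p \o @level G psi); split=> // [h|h h' n hn h'n u u' hu h'u'].
  by exists (p (level h)) => u /level_section /= ->.
rewrite /= (level_section _ _ hu) (level_section _ _ h'u').
rewrite (has_level_unique (has_level_level h) hn).
by rewrite (has_level_unique (has_level_level h') h'n).
Qed.
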